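(* Let $G$ be a chordal graph on at least $3$ vertices and let $\mathcal A(G)$ be the family of overspan graphs for $G$ (defined in the context). If for every $\mathcal B\subseteq\mathcal A(G)$ the matching number of $G_{\mathcal B}$ is greater than $2|\mathcal B|-2$, then $G$ is Hamiltonian.
   Context: A tree representation of a graph $G$ is a tree $T_0$ with a family $\mathcal F=\{F_v: v\in V(G)\}$ of subtrees of $T_0$ such that for distinct $u,v$, $uv\in E(G)$ iff $F_u$ and $F_v$ share a vertex. Fix one with $|V(T_0)|$ minimum. Choose an independent set $I$ of $G$ maximal with the property that for each $v\in I$, $F_v$ is a path all of whose vertices have degree at most $2$ in $T_0$; moreover $I$ is chosen so that for every $v\in I$, $F_v$ contains no member of $\mathcal F$ as a proper subgraph. For $v\in I$, $F_v$ is an $I$-path (trivial if it is a single vertex, which is then its endvertex). Colour each edge of $T_0$ red if it lies in some $I$-path and black otherwise. The base tree $T$ is obtained from $T_0$ by suppressing, one by one, every degree-$2$ vertex that is not an endvertex of any $I$-path; edges of $T$ inherit the colours. For an edge $e=rs$ of $T$, the overspan graph $A_e$ has vertex set $V(G)\setminus I$; it has a loop at $v$ if $F_v$ contains both $r$ and $s$, and an edge between distinct $u,v$ if $uv\in E(G)$ and ($r\in V(F_u)$, $s\in V(F_v)$ or vice versa). The family $\mathcal A(G)$ contains one graph $A_e$ for each red edge $e$ of $T$ and two copies of $A_e$ (distinct members) for each black edge $e$ of $T$; $|\mathcal B|$ counts members. For $\mathcal B\subseteq\mathcal A(G)$, $G_{\mathcal B}$ is the graph on $V(G)\setminus I$ whose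 edge set (including loops) is the union of the edge sets of members of $\mathcal B$. Matchings may contain loops, provided all edges in the matching are pairwise vertex-disjoint; the matching number is the maximum size of a matching. *)

(* Defs.v *)
From mathcomp Require Import all_boot.

Set Implicit Arguments.
Unset Strict Implicit.
Unset Printing Implicit Defensive.

Record sgraph := SGraph {
  vertex :> finType;
  adj : rel vertex;
  adj_sym : symmetric adj;
  adj_irrefl : irreflexive adj
}.

Section Graphs.
Variable G : sgraph.

Definition chordal : Prop :=
  forall p : seq G, ucycle (@adj G) p -> 4 <= size p ->
    exists x y : G,
      [/\ x \in p, y \in p, adj x y, y != next p x & x != next p y].

Definition hamiltonian : Prop :=
  exists p : seq G, [/\ ucycle (@adj G) p, 3 <= size p & forall x, x \in p].

Definition independent (I : {set G}) : Prop :=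
  {in I &, forall u v, ~~ adj u v}.

Definition degree (x : G) : nat := #|[set y | adj x y]|.

(* A cyclic sequence x, y along a single edge satisfies [ucycle], hence the
   bound 2 rather than 0 on the size. *)
Definition is_tree : Prop :=
  [/\ 0 < #|G|, forall x y : G, connect (@adj G) x y
    & forall p : seq G, ucycle (@adj G) p -> size p <= 2].

(* A subtree of a tree is the subgraph induced by its vertex set, so subtrees
   are represented by nonempty vertex sets inducing a connected subgraph. *)
Definition is_subtree (S : {set G}) : Prop :=
  S != set0 /\
  {in S &, forall x y,
     connect [rel a b | [&& a \in S, b \in S & adj a b]] x y}.

(* The subtree with vertex set S is a path (possibly a single vertex). *)
Definition is_path (S : {set G}) : Prop :=
  exists (x : G) (p : seq G),
    [/\ path (@adj G) x p, uniq (x :: p) & S = [set y in x :: p]].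

(* The vertices of the path with vertex set S having at most one neighbour on
   it; for S = [set x] this is x itself. *)
Definition endvertices (S : {set G}) : {set G} :=
  [set x in S | #|[set y in S | adj x y]| <= 1].

End Graphs.

(* Delete x and join its former neighbours. *)
Definition suppress (T : finType) (x : T) (e : rel T) : rel T :=
  fun u v => [&& u != x, v != x & e u v || [&& u != v, e u x & e x v]].

(* For a graph with loops given by its edge set, in which a loop at v is the
   singleton [set v] and an edge uv is the pair [set u; v]. *)
Definition matching_number (T : finType) (E : {set {set T}}) : nat :=
  \max_(M : {set {set T}} | (M \subset E) && trivIset M) #|M|.

Section Overspan.
Variables (G T0 : sgraph) (F : G -> {set T0}).

Definition tree_representation : Prop :=
  [/\ is_tree T0, forall v, is_subtree (F v)
    & forall u v : G, u != v -> adj u v = (F u :&: F v != set0)].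

Definition low_degree_path (v : G) : Prop :=
  is_path (F v) /\ {in F v, forall x, degree x <= 2}.

Definition path_independent (I : {set G}) : Prop :=
  independent I /\ {in I, forall v, low_degree_path v}.

Definition admissible (I : {set G}) : Prop :=
  [/\ path_independent I,
      forall J : {set G}, path_independent J -> I \subset J -> J = I
    & {in I, forall v (u : G), ~~ (F u \proper F v)}].

Variable I : {set G}.

Definition red : rel T0 :=
  fun x y => adj x y && [exists v in I, (x \in F v) && (y \in F v)].

Definition suppressed : {set T0} :=
  [set x | (degree x == 2) && [forall v in I, x \notin endvertices (F v)]].

(* Suppressing a vertex of a tree does not change the degrees of the remaining
   vertices, so the vertices to suppress can be determined in T0 beforehand. *)
Definition base_adj : rel T0 :=
  foldr (@suppress T0) (@adj T0) (enum suppressed).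

(* The two edges merged by a suppression have the same colour, because the
   suppressed vertex is not an endvertex of an I-path. Thus the red edges of
   the base tree come from merging red edges only. *)
Definition base_red : rel T0 :=
  foldr (@suppress T0) red (enum suppressed).

Definition base_edges : {set {set T0}} :=
  [set e | [exists r, exists s, (e == [set r; s]) && base_adj r s]].

Definition red_edges : {set {set T0}} :=
  [set e | [exists r, exists s, (e == [set r; s]) && base_red r s]].

Definition overspan_loops (e : {set T0}) : {set {set G}} :=
  [set [set v] | v in ~: I & e \subset F v].

(* (r, s) ranges over both orderings of the ends of e. *)
Definition overspan_links (e : {set T0}) : {set {set G}} :=
  [set [set u; v] | u in ~: I, v in ~: I &
     [&& u != v, adj u v
       & [exists r, exists s, [&& e == [set r; s], r \in F u & s \in F v]]]].

Definition overspan (e : {set T0}) : {set {set G}} :=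
  overspan_loops e :|: overspan_links e.

(* (e, b) stands for a copy of the overspan graph of e: there is only the copy
   (e, false) if e is red, and there are two copies if e is black. *)
Definition overspan_family : {set {set T0} * bool} :=
  [set m | (m.1 \in base_edges) && ((m.1 \in red_edges) ==> ~~ m.2)].

Definition overspan_union (B : {set {set T0} * bool}) : {set {set G}} :=
  \bigcup_(m in B) overspan m.1.

End Overspan.

Definition minimum_tree_representation (G T0 : sgraph) (F : G -> {set T0}) :
    Prop :=
  tree_representation F /\
  forall (T1 : sgraph) (F1 : G -> {set T1}),
    tree_representation F1 -> #|T0| <= #|T1|.

(* Main.v *)
Require Import Defs.
From mathcomp Require Import all_boot zify.

(* By the Aharoni-Haxell version of Hall's theorem, the overspan graphs have
   pairwise disjoint representing edges. It is obtained here from Meshulam's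
   criterion for independent transversals, with chains over F_2: if, for every
   set B of colours, all (|B| - 2)-cycles of the independence complex bound
   inside the vertices coloured by B, then a Sperner parity argument yields a
   rainbow independent set. For the complex of matchings, the fillings come from
   a deletion-explosion induction, in which each explosion destroys at most two
   members of a given matching.

   Given the representatives, each edge of the base tree can be crossed twice in
   G by disjoint sets of vertices: for a black edge these are the two
   representatives, for a red one the representative and the vertex of I whose
   path is that edge. Walking around a doubled spanning tree yields a cycle of G
   that visits every vertex of the base tree. Every F_w contains a vertex of the
   base tree, by the choice of I, so all remaining vertices w of G can be
   inserted into the cycle. *)

Set Implicit Arguments.
Unset Strict Implicit.
Unset Printing Implicit Defensive.

(** * Fillings in independence complexes *)

(** Over F_2 the summands at (i, j) and (j, i) cancel; [enum_rank] only separates the two orders.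
    This is what makes a boundary of a boundary vanish, both for chains and for the colour simplices
    below. *)
Lemma addb_big_symmetric (T : finType) (P : pred T) (h : T -> T -> bool) :
  (forall i j, h i j = h j i) ->
  \big[addb/false]_(i | P i) \big[addb/false]_(j | P j && (j != i)) h i j
    = false.
Proof.
move=> hC.
transitivity (\big[addb/false]_(i | P i)
  (\big[addb/false]_(j | P j && (enum_rank j < enum_rank i)) h i j (+)
   \big[addb/false]_(j | P j && (enum_rank i < enum_rank j)) h i j)).
  apply: eq_bigr => i _; rewrite (bigID (fun j => enum_rank j < enum_rank i)).
  congr (_ (+) _); apply: eq_bigl => j.
    rewrite -andbA; congr (_ && _); case: eqVneq => [->|//].
    by rewrite ltnn.
  rewrite -andbA -leqNgt ltn_neqAle; congr (_ && (_ && _)).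
  by rewrite eq_sym -(inj_eq (@enum_rank_inj T)).
rewrite big_split /= [X in _ (+) X](exchange_big_dep P) //=; last first.
  by move=> i j _ /andP[].
set u := (X in X (+) _); set v := (X in _ (+) X).
suff -> : v = u by rewrite addbb.
apply: eq_bigr => i Pi.
by apply: eq_big => [j|j _]; rewrite ?Pi // andbC.
Qed.

Lemma addb_eq_false a b : a (+) b = false -> a = b.
Proof. by case: a b => [] []. Qed.

Section Chains.
Variable X : finType.
Implicit Types (c z : {set X} -> bool) (s t : {set X}) (r : rel X).

(* Chains over F_2; the coefficient of [s] in the boundary is read off the
   simplices having [s] as a facet. *)
Definition boundary c s : bool := \big[addb/false]_(x | x \notin s) c (x |: s).

Definition cycle_chain c := forall s, boundary c s = false.

Definition indep r (A s : {set X}) :=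
  (s \subset A) && [forall x in s, forall y in s, ~~ r x y].

(** Here [k] counts vertices, so these are chains of dimension k - 1, and the empty set is a
    simplex. Thus [fillable K k] says that reduced homology vanishes in dimension k - 1; for k = 0
    it says that there is a vertex. *)
Definition supported (K : pred {set X}) k c := forall s, c s -> K s /\ #|s| = k.

Definition fillable (K : pred {set X}) k :=
  forall z, supported K k z -> cycle_chain z ->
    exists2 c, supported K k.+1 c & boundary c =1 z.

Lemma boundaryD c c' s :
  boundary (fun t => c t (+) c' t) s = boundary c s (+) boundary c' s.
Proof. exact: big_split. Qed.

Lemma boundary_boundary c : cycle_chain (boundary c).
Proof.
move=> s; rewrite /boundary -[RHS](addb_big_symmetric
  (fun x => x \notin s) (h := fun x y => c (y |: (x |: s)))); last first.
  by move=> i j; rewrite setUCA.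
by apply: eq_bigr => x _; apply: eq_bigl => y; rewrite !inE negb_or andbC.
Qed.

Definition cone m z s := (m \in s) && z (s :\ m).

(** Only the simplices of [z] avoiding [m] are coned. That suffices, because the cycle condition at
    [s :\ m] expresses the coefficient of a simplex [s] containing [m] through simplices that avoid
    [m]. *)
Lemma boundary_cone m z : cycle_chain z -> boundary (cone m z) =1 z.
Proof.
move=> zz s; rewrite /boundary /cone; case: (boolP (m \in s)) => ms; last first.
  rewrite (bigD1 m) //= setU11 setU1K // big1 ?addbF // => x /andP[_ xm].
  by rewrite !inE eq_sym (negPf xm) (negPf ms).
have := zz (s :\ m); rewrite /boundary (bigD1 m) ?setD11 //= setD1K //.
move/addb_eq_false ->; apply: eq_big => [x|x xs].
  by rewrite !inE negb_and negbK andb_orl andbN /= andbC;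
    case: eqVneq => [->|] //=; rewrite ms.
have xm : x != m by apply: contraNneq xs => ->.
rewrite !inE ms orbT /=; congr z; apply/setP=> y; rewrite !inE.
by case: (eqVneq y x) => [->|] //=; rewrite xm.
Qed.

Lemma indepP r (A s : {set X}) :
  reflect (s \subset A /\ {in s &, forall x y, ~~ r x y}) (indep r A s).
Proof.
apply: (iffP andP) => [[sA /forall_inP h]|[sA h]]; split => //.
  by move=> x y xs ys; have /forall_inP := h x xs; apply.
by apply/forall_inP => x xs; apply/forall_inP => y ys; apply: h.
Qed.

Definition del_edge r x y : rel X :=
  fun a b => r a b && ([set a; b] != [set x; y]).

(** If [x] and [y] are adjacent, they are removed as well, so the independent sets that remain form
    the link of the simplex xy in the complex obtained by deleting the edge. *)
Definition explode r (A : {set X}) x y := [set a in A | ~~ r a x && ~~ r a y].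

(* Given a filling [c] of [z] after the deletion of the edge [xy], the link of
   [xy] in [c] is a cycle of the exploded complex; if it bounds [b] there, then
   adding the boundary of [b * xy] to [c] removes the simplices containing
   [xy]. *)
Lemma fillable_del_explode r (A : {set X}) x y k :
  symmetric r -> irreflexive r -> x \in A -> y \in A -> r x y ->
  fillable (indep (del_edge r x y) A) k.+1 ->
  fillable (indep r (explode r A x y)) k -> fillable (indep r A) k.+1.
Proof.
move=> rC rI xA yA rxy fdel fexp z zK zz.
have xy : x != y by apply: contraTneq rxy => ->; rewrite rI.
have ryx : r y x by rewrite rC.
have zdel : supported (indep (del_edge r x y) A) k.+1 z.
  move=> s /zK[/indepP[sA h] ->]; split=> //; apply/indepP;
    split=> // a b as_ bs.
  by rewrite /del_edge (negPf (h a b as_ bs)).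
have [c cK cz] := fdel z zdel zz.
pose d s := [&& x \notin s, y \notin s & c (x |: (y |: s))].
have dK : supported (indep r (explode r A x y)) k d.
  move=> s /and3P[xs ys /cK[/indepP[sA h] sz]]; split; last first.
    by move: sz; rewrite !cardsU1 !inE negb_or xy xs ys => -[].
  have hin a b : a \in x |: (y |: s) -> b \in x |: (y |: s) ->
      [set a; b] != [set x; y] -> ~~ r a b.
    by move=> ha hb ne; have := h a b ha hb; rewrite /del_edge ne andbT.
  have ne a b : a \in s -> [set a; b] != [set x; y].
    move=> as_; apply/eqP => /setP/(_ a); rewrite !inE eqxx /=.
    by case/esym/orP => /eqP ax; [rewrite -ax as_ in xs | rewrite -ax as_ in
      ys].
  have ins a : a \in s -> a \in x |: (y |: s) by move=> as_;
      rewrite !inE as_ !orbT.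
  apply/indepP; split=> [|a b as_ bs]; last by apply: hin; rewrite ?ins ?ne.
  apply/subsetP => a as_; rewrite inE (subsetP sA _ (ins a as_)) /=.
  apply/andP; split; apply: hin; rewrite ?ne // ?(ins a) // !inE eqxx ?orbT //.
have zxy s : x \in s -> y \in s -> z s = false.
  by move=> xs ys; apply/negP=> /zK[/indepP[_ h] _]; have := h x y xs ys;
    rewrite rxy.
(* The boundary of [d] at [s] is that of [c] at [x |: (y |: s)], hence the value of [z] there, and
   [z] vanishes on simplices containing both [x] and [y]. *)
have dz : cycle_chain d.
  move=> s; rewrite /boundary.
  case: (boolP ((x \in s) || (y \in s))) => [xys|].
    by apply: big1 => a _; rewrite /d !inE; case/orP: xys => ->;
      rewrite !orbT ?andbF.
  rewrite negb_or => /andP[xs ys].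
  have := cz (x |: (y |: s)); rewrite zxy ?inE ?eqxx ?orbT // => e0;
      rewrite -[RHS]e0.
  rewrite /boundary [RHS]big_mkcond [LHS]big_mkcond.
  apply: eq_bigr => a _; rewrite /d !inE !(eq_sym _ a) !negb_or xs ys !andbT.
  case: eqVneq => [->|ax] /=; first by rewrite if_same.
  case: eqVneq => [->|ay] /=; first by rewrite if_same.
  case: (boolP (a \in s)) => // as_.
  by congr c; apply/setP=> u; rewrite !inE !orbA (orbC (u == a)) -!orbA (orbCA
    (u == a)).
have [b bK bd] := fexp d dK dz.
have bx s : x \in s -> b s = false.
  move=> xs; apply/negP=> /bK[/indepP[/subsetP/(_ x xs)]].
  by rewrite inE rxy andbF andbF.
have by_ s : y \in s -> b s = false.
  move=> ys; apply/negP=> /bK[/indepP[/subsetP/(_ y ys)]].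
  by rewrite inE ryx andbF.
(* The join of [b] with the simplex xy. *)
pose g s := [&& x \in s, y \in s & b (s :\ x :\ y)].
exists (fun s => c s (+) boundary g s); last first.
  by move=> s; rewrite boundaryD cz boundary_boundary addbF.
(* On simplices containing xy the boundary of [g] equals [c], so the two cancel exactly where
   independence for [r] could fail. *)
have both s : x \in s -> y \in s -> boundary g s = c s.
  move=> xs ys; have := bd (s :\ x :\ y); rewrite /d !inE !eqxx /= andbF /=.
  have -> : x |: (y |: s :\ x :\ y) = s.
    by rewrite setD1K ?setD1K // !inE ys eq_sym xy.
  move=> <-; rewrite /boundary [RHS]big_mkcond [LHS]big_mkcond.
  apply: eq_bigr => a _; rewrite /g !inE xs ys !orbT /= !negb_and !negbK.
  case: (eqVneq a x) => [->|ax].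
    by rewrite xs orbT /= bx // setU11.
  case: (eqVneq a y) => [->|ay].
    by rewrite ys /= by_ // setU11.
  case: (boolP (a \in s)) => // as_ /=.
  congr b; apply/setP=> u; rewrite !inE.
  by case: (eqVneq u a) => [->|_]; rewrite ?ax ?ay.
(* The new simplices consist of a simplex of [b] and one of [x], [y]; they are independent since the
   explosion removed all neighbours of both. *)
have addK v u s : b s -> (v == x) || (v == y) -> v \notin s -> u = v |: s ->
    indep r A u /\ #|u| = k.+2.
  move=> bs vxy vs ->; have [/indepP[sA h] sk] := bK s bs; split; last first.
    by rewrite cardsU1 vs sk.
  have vs' a : a \in s -> ~~ r a v.
    move=> /(subsetP sA); rewrite inE => /and3P[_ h1 h2].
    by case/orP: vxy => /eqP ->.
  apply/indepP; split.
    apply/subsetP => a; rewrite !inE => /orP[/eqP->|/(subsetP sA)].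
      by case/orP: vxy => /eqP ->.
    by rewrite inE => /andP[].
  move=> a a'; rewrite !inE => /orP[/eqP->|as_] /orP[/eqP->|as'].
  - by rewrite rI.
  - by rewrite rC vs'.
  - exact: vs'.
  - exact: h.
move=> s; case: (boolP ((x \in s) && (y \in s))) => [/andP[xs ys]|nxy].
  by rewrite both // addbb.
case: (boolP (c s)) => [cs _|_ /=].
  have [/indepP[sA h] sk] := cK s cs; split=> //; apply/indepP;
      split=> // a a' as_ as'.
  have := h a a' as_ as'; rewrite /del_edge negb_and negbK => /orP[//|/eqP e].
  have [xa ya] : x \in [set a; a'] /\ y \in [set a;
      a'] by rewrite e !inE !eqxx orbT.
  have sub : [set a; a'] \subset s by rewrite subUset !sub1set as_.
  by case/negP: nxy; rewrite !(subsetP sub).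
move=> bg; have [a as_ ] : exists2 a, a \notin s & g (a |: s).
  apply/exists_inP; apply: contraT => /exists_inPn h; move: bg.
  by rewrite /boundary big1 // => a /h /negPf.
rewrite /g !inE => /and3P[xas yas bas].
have [e|e] : a = x \/ a = y.
  case: (eqVneq x a) xas => [->|_ /= xs]; first by left.
  by case: (eqVneq y a) yas => [->|_ /= ys]; [right | rewrite xs ys in nxy].
- have ys : y \in s by move: yas; rewrite e eq_sym (negPf xy).
  apply: (addK y s _ bas); rewrite ?eqxx ?orbT ?inE ?eqxx //.
  by apply/setP => u; rewrite e !inE; case: (eqVneq u y) => [->|_] //=;
    case: (eqVneq u x) as_ => [->|_] //; rewrite e => /negPf.
- have xs : x \in s by move: xas; rewrite e (negPf xy).
  apply: (addK x s _ bas); rewrite ?eqxx ?orbT ?inE ?eqxx ?andbF //.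
  by apply/setP => u; rewrite e !inE; case: (eqVneq u x) => [->|_] //=;
    case: (eqVneq u y) as_ => [->|_] //; rewrite e => /negPf.
Qed.

(* Meshulam's game: always offer an edge [mf] with [m] in [M]. Its explosion
   destroys only the members of [M] adjacent to [f], and if no such edge is
   left, then the complex is a cone over any member of [M]. *)
Lemma fillable_of_independent r (A M : {set X}) k :
  symmetric r -> irreflexive r -> indep r A M ->
  {in A, forall a, #|[set m in M | r a m]| <= 2} ->
  2 * k < #|M| -> fillable (indep r A) k.
Proof.
elim: k r A M => [|k IHk] r A M.
  move=> rC rI /indepP[/subsetP MA _] _ /card_gt0P[m mM] z zK zz.
  exists (cone m z); last exact: boundary_cone.
  move=> s /andP[ms /zK[_ /eqP]]; rewrite cards_eq0 => /eqP s0.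
  have -> : s = [set m] by rewrite -(setD1K ms) s0 setU0.
  rewrite cards1; split=> //; apply/indepP; split; first by rewrite sub1set MA.
  by move=> x y; rewrite !inE => /eqP-> /eqP->; rewrite rI.
(* Inner induction on the number of ordered adjacent pairs: a deletion keeps [k] and lowers this
   number, an explosion lowers [k]. *)
have [n] := ubnP #|[set p : X * X | r p.1 p.2]|.
elim: n r A M => // n IHn r A M lt rC rI MI MA2 Mk.
have /indepP[/subsetP MA Mr] := MI.
have [m mM] : exists m, m \in M by apply/card_gt0P; apply: leq_trans Mk.
case: (boolP [exists f in A, r m f]) => [/exists_inP[f fA rmf]|/exists_inPn
  iso].
  apply: (@fillable_del_explode r A m f) => //; first exact: MA.
    apply: (IHn _ _ M) => //.
    - rewrite ltnS in lt; apply: leq_trans lt; apply: proper_card.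
      apply/properP; split.
        by apply/subsetP=> p; rewrite !inE => /andP[].
      by exists (m, f); rewrite !inE //= /del_edge eqxx andbF.
    - by move=> a b; rewrite /del_edge rC setUC.
    - by move=> a; rewrite /del_edge rI.
    - apply/indepP; split; first exact/subsetP.
      by move=> a b aM bM; rewrite /del_edge (negPf (Mr _ _ aM bM)).
    - move=> a aA; apply: leq_trans (MA2 a aA); apply: subset_leq_card.
      by apply/subsetP=> b; rewrite !inE => /andP[-> /andP[]].
  apply: (IHk _ _ (M :\: [set b in M | r f b])) => //.
  - apply/indepP; split; last first.
      by move=> a b /setDP[aM _] /setDP[bM _]; apply: Mr.
    apply/subsetP=> b; rewrite !inE => /andP[+ bM].
    by rewrite bM /= MA //= (Mr b m) //= (rC b).
  - move=> a; rewrite inE => /andP[aA _]; apply: leq_trans (MA2 a aA).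
    apply: subset_leq_card.
    by apply/subsetP=> b; rewrite !inE => /andP[/andP[_ ->] ->].
  - have := MA2 f fA; move: Mk.
    rewrite -(cardsID [set b in M | r f b] M) (setIidPr _); last first.
      by apply/subsetP=> b; rewrite inE => /andP[].
    by move: #|_| #|_| => p q; rewrite mulnS => h1 h2;
      rewrite -(ltn_add2l 2); apply: leq_trans h1 _; rewrite leq_add2r.
move=> z zK zz; exists (cone m z); last exact: boundary_cone.
move=> s /andP[ms /zK[/indepP[sA h] sk]]; split;
  last by rewrite (cardsD1 m) ms sk.
have sA' : s \subset A by rewrite -(setD1K ms) subUset sub1set MA.
apply/indepP; split=> // a b.
rewrite -{1 2}(setD1K ms) !in_setU1 => /orP[/eqP->|as_] /orP[/eqP->|bs].
- by rewrite rI.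
- by rewrite iso // (subsetP sA).
- by rewrite rC iso // (subsetP sA).
- exact: h.
Qed.

End Chains.

(** * Hall's theorem for hypergraphs of rank two *)

Section IndependentTransversal.
Variables (X J : finType) (col : X ->
  J) (r : rel X) (A : {set X}) (D : {set J}).

Definition coloured_in (B : {set J}) := [set x in A | col x \in B].

Hypothesis fillD : forall B : {set J}, B \subset D -> B != set0 ->
  fillable (indep r (coloured_in B)) #|B|.-1.

Lemma indep_coloured_sub (B B' : {set J}) s :
  B \subset B' -> indep r (coloured_in B) s -> indep r (coloured_in B') s.
Proof.
move=> BB /indepP[sA h]; apply/indepP; split=> //.
apply: subset_trans sA _; apply/subsetP=> x; rewrite !inE => /andP[-> /=].
exact/subsetP.
Qed.

(* [c B] plays the role of the image of the simplex [B] under a chain map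
   defined on the full simplex with vertex set [D]. *)
Lemma filling_family : exists c : {set J} -> {set X} -> bool,
  [/\ c set0 =1 (fun s => s == set0)
    & forall B : {set J}, B \subset D ->
        supported (indep r (coloured_in B)) #|B| (c B) /\
        boundary (c B) =1 (fun s => \big[addb/false]_(i in B) c (B :\ i) s)].
Proof.
suff [c [c0 cP]] : exists c : {set J} -> {set X} -> bool,
  [/\ c set0 =1 (fun s => s == set0)
    & forall B : {set J}, #|B| <= #|D| -> B \subset D ->
        supported (indep r (coloured_in B)) #|B| (c B) /\
        boundary (c B) =1 (fun s => \big[addb/false]_(i in B) c (B :\ i) s)].
  by exists c; split=> // B BD; apply: cP; rewrite ?subset_leq_card.
(* Only the numerical bound on the size of [B] varies; [D] itself stays fixed. *)
elim: #|D| => [|n [c [c0 cP]]].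
  exists (fun _ s => s == set0); split=> // B.
  rewrite leqn0 cards_eq0 => /eqP -> _; split=> [s /eqP->|s].
    rewrite !cards0; split=> //; apply/indepP; split; first exact: sub0set.
    by move=> x y; rewrite inE.
  rewrite big_set0; apply: big1 => x _; apply/eqP => e.
  by have := setU11 x s; rewrite e inE.
have /fin_all_exists[u uP] (B : {set J}) : exists u : {set X} -> bool,
    B \subset D -> #|B| = n.+1 ->
    supported (indep r (coloured_in B)) #|B| u /\
    boundary u =1 (fun s => \big[addb/false]_(i in B) c (B :\ i) s).
  case: (boolP ((B \subset D) && (#|B| == n.+1))) => [/andP[BD /eqP Bn]|h];
    last first.
    by exists xpred0 => BD Bn; rewrite BD Bn eqxx in h.
  have B0 : B != set0 by rewrite -card_gt0 Bn.
  have cB i : i \in B -> supported (indep r (coloured_in (B :\ i))) n (c (B :\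
      i)) /\
      boundary (c (B :\ i)) =1
      (fun s => \big[addb/false]_(j in B :\ i) c (B :\ i :\ j) s).
    move=> iB; have Bi : #|B :\ i| = n by move: Bn;
      rewrite (cardsD1 i) iB => -[].
    rewrite -{1}Bi; apply: cP; first by rewrite Bi.
    by apply: subset_trans BD; apply: subD1set.
  have [||u uK uz] := fillD BD B0 (z :=
      fun s => \big[addb/false]_(i in B) c (B :\ i) s).
  - move=> s; rewrite Bn /=; case: (boolP [exists i in B, c (B :\ i) s]).
      move=> /exists_inP[i iB /(cB i iB).1[sK ->]] _; split=> //.
      by apply: indep_coloured_sub sK; apply: subD1set.
    by move=> /exists_inPn h; rewrite big1 // => i /h /negPf.
  (* The prescribed boundary is a cycle: each pair i, j of colours is removed once in each order. *)
  - move=> s; rewrite /boundary exchange_big /=.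
    rewrite -[RHS](addb_big_symmetric (mem B) (h :=
      fun i j => c (B :\ i :\ j) s)).
      apply: eq_bigr => i iB; rewrite -/(boundary _ _) (cB i iB).2.
      by apply: eq_bigl => j; rewrite !inE andbC.
    by move=> i j; rewrite setDDl setUC -setDDl.
  - by exists u => _ _; rewrite Bn in uK *.
exists (fun B : {set J} => if #|B| <= n then c B else u B); split=> [|B Bn BD].
  by rewrite cards0.
have e : (fun s => \big[addb/false]_(i in B) (if #|B :\ i| <= n then c (B :\ i)
    else u (B :\ i)) s)
     =1 (fun s => \big[addb/false]_(i in B) c (B :\ i) s).
  move=> s; apply: eq_bigr => i iB; case: ifP => //.
  by move: Bn; rewrite (cardsD1 i) iB add1n ltnS => ->.
case: leqP => h.
  by have [? h2] := cP B h BD; split=> // s; rewrite h2 e.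
have [|? h2] := uP B BD; first by apply/eqP; rewrite eqn_leq Bn.
by split=> // s; rewrite h2 e.
Qed.

(* A simplex has one facet with colours exactly [B :\ i] if it is rainbow, and
   none or two otherwise. *)
Lemma rainbow_facets (B : {set J}) i (s : {set X}) :
  i \in B -> #|s| = #|B| -> col @: s \subset B ->
  \big[addb/false]_(x in s) (col @: (s :\ x) == B :\ i) = (col @: s == B).
Proof.
move=> iB sB csB.
case: (boolP [exists x in s, col @: (s :\ x) == B :\ i]); last first.
  move=> /exists_inPn none; rewrite big1; last by move=> x /none/negPf.
  apply/esym/eqP => cs.
  have inj : {in s &, injective col} by apply/imset_injP; rewrite cs sB.
  have /imsetP[x xs ix] : i \in col @: s by rewrite cs.
  have /negP[] := none x xs; apply/eqP/setP=> j; rewrite -cs !inE.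
  apply/imsetP/andP => [[y]|[ji /imsetP[y ys e]]].
    rewrite !inE => /andP[yx ys] ->; rewrite imset_f //; split=> //.
    by apply: contraNneq yx; rewrite ix => /inj ->.
  by exists y => //; rewrite !inE ys andbT; apply: contraNneq ji;
    rewrite ix e => ->.
move=> /exists_inP[x xs /eqP cx].
have sx : #|s :\ x| = #|B :\ i|.
  by move: sB; rewrite (cardsD1 x s) (cardsD1 i B) xs iB => -[].
have inj : {in s :\ x &, injective col} by apply/imset_injP; rewrite cx sx.
have csx : col @: s = col x |: (B :\ i) by rewrite -{1}(setD1K xs) imsetU1 cx.
rewrite (bigD1 x) //= cx eqxx.
case: (eqVneq (col x) i) => [xi|xi].
  rewrite csx xi setD1K // eqxx big1 // => y /andP[ys yx]; apply/eqP => e.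
  have : col x \in col @: (s :\ y) by rewrite imset_f // !inE xs eq_sym yx.
  by rewrite e xi !inE eqxx.
(* The colour of [x] recurs at some [y], so precisely the facets opposite [x] and [y] qualify, and
   they cancel. *)
have cxB : col x \in B :\ i by rewrite !inE xi (subsetP csB) // imset_f.
have -> : (col @: s == B) = false.
  rewrite csx (setUidPr _) ?sub1set //; apply/eqP=> /setP/(_ i).
  by rewrite !inE eqxx iB.
have /imsetP[y] : col x \in col @: (s :\ x) by rewrite cx.
rewrite !inE => /andP[yx ys] xy.
rewrite (bigD1 y) ?ys //= big1.
  suff -> : col @: (s :\ y) = B :\ i by rewrite eqxx.
  apply/eqP; rewrite eqEsubset; apply/andP; split.
    rewrite -(setUidPr (_ : [set col x] \subset B :\ i)) ?sub1set // -csx.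
    by apply: imsetS; apply: subD1set.
  rewrite -cx; apply/subsetP=> j /imsetP[w]; rewrite !inE => /andP[wx ws] ->.
  case: (eqVneq w y) => [->|wy]; last by rewrite imset_f // !inE wy.
  by rewrite -xy imset_f // !inE eq_sym yx.
move=> w /andP[/andP[ws wx] wy]; apply/eqP=> e.
have : col w \in col @: (s :\ w) by rewrite e -cx imset_f // !inE wx.
case/imsetP=> v; rewrite !inE => /andP[vw vs] wv.
case: (eqVneq v x) => [vx|vx].
  by move: wv; rewrite vx xy => /inj;
    rewrite !inE ws wx ys yx => /(_ isT isT) e'; rewrite e' eqxx in wy.
by move/inj: wv; rewrite !inE ws wx vs vx => /(_ isT isT) e';
  rewrite e' eqxx in vw.
Qed.

(** Sperner's argument: the number of simplices of [c B] with colour set exactly [B] is odd for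
    every [B], by induction on its size. Modulo 2 that number counts the simplices with colour set
    [B :\ i] in the boundary of [c B], and these come from [c (B :\ i)] alone. *)
Lemma independent_transversal :
  exists2 s : {set X}, indep r A s & col @: s = D.
Proof.
have [c [c0 cP]] := filling_family.
have restr (B : {set J}) s : indep r (coloured_in B) s ->
    indep r A s /\ col @: s \subset B.
  move=> /indepP[/subsetP sA h]; split.
    apply/indepP; split=> //; apply/subsetP=> x /sA; rewrite inE.
    by case/andP.
  by apply/subsetP=> _ /imsetP[x /sA + ->]; rewrite inE => /andP[].
suff par : forall n (B : {set J}), #|B| = n -> B \subset D ->
    \big[addb/false]_(s : {set X} | (col @: s == B) && (#|s| == #|B|)) c B s =
      true.
  have := par _ D erefl (subxx _).
  case: (boolP [exists s : {set X}, [&& col @: s == D, #|s| == #|D| & c D s]]).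
    move=> /existsP[s /and3P[/eqP csD _ /(cP D (subxx _)).1[/restr[sA _] _]]] _.
    by exists s.
  rewrite negb_exists => /forallP none; rewrite big1 // => s /andP[s1 s2].
  by have := none s; rewrite s1 s2 => /negPf.
elim=> [|n IHn] B Bn BD.
  move/eqP: Bn; rewrite cards_eq0 => /eqP ->.
  rewrite (bigD1 set0) /=; last by rewrite imset0 !cards0 !eqxx.
  by rewrite c0 eqxx big1 // => s /andP[_ /negPf h]; rewrite c0.
have [i iB] : exists i, i \in B by apply/card_gt0P; rewrite Bn.
have Bi : #|B :\ i| = n by move: Bn; rewrite (cardsD1 i) iB => -[].
have BiD : B :\ i \subset D by apply: subset_trans BD; apply: subD1set.
have [cK cb] := cP B BD.
rewrite -(IHn _ Bi BiD).
transitivity (\big[addb/false]_(t : {set X} | (col @: t == B :\ i) && (#|t| ==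
  #|B :\ i|)) boundary (c B) t).
  transitivity (\big[addb/false]_(s : {set X}) \big[addb/false]_(x in s)
      (c B s && (col @: (s :\ x) == B :\ i))).
    rewrite big_mkcond; apply: eq_bigr => s _.
    case: (boolP (c B s)) => [cs|_]; last by rewrite if_same big1.
    have [/restr[_ csB] sB] := cK s cs.
    by rewrite rainbow_facets // sB eqxx andbT; case: ifP.
  rewrite (exchange_big_dep xpredT) //= [RHS](exchange_big_dep xpredT) //=.
  apply: eq_bigr => x _.
  rewrite (reindex_onto (fun t => x |: t) (fun s => s :\ x)) /=;
    last by move=> s; apply: setD1K.
  rewrite big_mkcond [RHS]big_mkcond; apply: eq_bigr => t _.
  rewrite setU11 /=; case: (boolP (x \in t)) => xt.
    rewrite andbF; case: eqP => // e; have := setD11 x (x |: t).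
    by rewrite e xt.
  rewrite setU1K // eqxx andbT.
  case: (boolP (c B (x |: t))) => [/cK[_]|_] /=; last by rewrite if_same.
  rewrite cardsU1 xt (cardsD1 i) iB => /addnI ->; rewrite eqxx andbT.
  by case: ifP.
transitivity (\big[addb/false]_(j in B)
   \big[addb/false]_(t : {set X} | (col @: t == B :\ i) && (#|t| == #|B :\ i|))
     c (B :\ j) t).
  by rewrite exchange_big /=; apply: eq_bigr => t _.
(* For j other than i, simplices of [c (B :\ j)] miss the colour j, which belongs to [B :\ i]. *)
rewrite (bigD1 i) //= [X in _ (+) X]big1 ?addbF // => j /andP[jB ji].
apply: big1 => t /andP[/eqP ct _]; apply/negP.
have BjD : B :\ j \subset D by apply: subset_trans BD; apply: subD1set.
move=> /(cP _ BjD).1[/restr[_ /subsetP sub] _].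
by have := sub j; rewrite ct !inE eqxx jB ji => /(_ isT).
Qed.

End IndependentTransversal.

(* The Aharoni-Haxell theorem for hyperedges of size at most 2. *)
Lemma disjoint_representatives (J V : finType) (D : {set J}) (E : J ->
    {set {set V}}) :
  {in D, forall m, {in E m, forall e : {set V}, #|e| <= 2}} ->
  (forall B : {set J}, B \subset D ->
     2 * #|B| < matching_number (\bigcup_(m in B) E m) + 2) ->
  exists2 f : J -> {set V}, {in D, forall m, f m \in E m}
    & {in D &, forall m m', m != m' -> [disjoint f m & f m']}.
Proof.
move=> E2 hall.
(* An edge lying in several members gives one vertex per colour; such copies conflict unless the
   edge is empty. *)
pose X := (J * {set V})%type.
pose r : rel X := fun p q => (p != q) && ~~ [disjoint p.2 & q.2].
pose A := [set p : X | (p.1 \in D) && (p.2 \in E p.1)].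
have rC : symmetric r by move=> p q; rewrite /r eq_sym disjoint_sym.
have rI : irreflexive r by move=> p; rewrite /r eqxx.
have [|s /indepP[/subsetP sA sr] sD] :=
    @independent_transversal X J (fun p => p.1) r A D.
  move=> B BD B0.
  have B1 : 0 < #|B| by rewrite card_gt0.
  have := hall B BD.
  have [M /andP[/subsetP ME Mt] ->] : {M : {set {set V}} |
      (M \subset \bigcup_(m in B) E m) && trivIset M &
      matching_number (\bigcup_(m in B) E m) = #|M|}.
    apply: eq_bigmax_cond; apply/card_gt0P; exists set0.
    by rewrite unfold_in sub0set /trivIset /cover !big_set0 cards0 eqxx.
  move=> BM.
  have /fin_all_exists[g gP] (e : {set V}) : exists m, e \in M ->
      m \in B /\ e \in E m.
    case: (boolP (e \in M)) => [/ME/bigcupP[m mB eE]|_]; first by exists m.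
    by have [m _] := card_gt0P B1; exists m.
  apply: (@fillable_of_independent _ _ _ [set (g e, e) | e in M]) => //.
  - apply/indepP; split.
      apply/subsetP=> _ /imsetP[e eM ->]; rewrite !inE /=.
      by have [h1 h2] := gP e eM; rewrite h1 h2 (subsetP BD).
    move=> _ _ /imsetP[e eM ->] /imsetP[e' eM' ->];
      rewrite /r /= negb_and !negbK.
    case: (eqVneq e e') => [->|ne]; first by rewrite eqxx.
    by rewrite (trivIsetP Mt) ?orbT.
  - move=> a; rewrite !inE => /andP[/andP[aD aE] _].
    apply: leq_trans (E2 _ aD _ aE).
    have [a0|[v0 v0a]] := set_0Vmem a.2.
      rewrite a0 cards0 leqn0 cards_eq0; apply/eqP/setP=> p; rewrite !inE /r.
      by rewrite a0 disjoints_subset sub0set !andbF.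
    (* Each matching edge meeting [a.2] is charged to a common vertex. Matching edges are disjoint,
       so the charge is injective and at most [#|a.2|] of them are hit. *)
    pose h (p : X) := odflt v0 [pick v in a.2 :&: p.2].
    have hP (p : X) : r a p -> h p \in a.2 :&: p.2.
      rewrite /r -setI_eq0 => /andP[_ /set0Pn[v va]]; rewrite /h.
      by case: pickP => [//|/(_ v)]; rewrite va.
    rewrite -(card_in_imset (f := h)).
      apply: subset_leq_card; apply/subsetP=> _ /imsetP[p + ->].
      by rewrite inE => /andP[_ /hP]; rewrite inE => /andP[].
    move=> p q; rewrite !inE => /andP[/imsetP[e eM ->] /hP he] /andP[/imsetP[e'
      eM' ->] /hP he'] eh.
    case: (eqVneq e e') => [->//|ne].
    have := trivIsetP Mt e e' eM eM' ne;
        rewrite -setI_eq0 => /eqP/setP/(_ (h (g e, e))).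
    by move: he he'; rewrite -eh !inE /= => /andP[_ ->] /andP[_ ->].
  - rewrite card_imset; last by move=> e e' [].
    by move: BM B1; case: #|B| => // k; rewrite mulnS addnC ltn_add2r.
have /fin_all_exists[f fP] (m : J) : exists e : {set V}, m \in D ->
    (m, e) \in s.
  case: (boolP (m \in D)) => [|_]; last by exists set0.
  by rewrite -sD => /imsetP[[m' e] es ->]; exists e.
exists f => [m mD|m m' mD mD' ne].
  by have := sA _ (fP m mD); rewrite inE => /andP[].
have := sr _ _ (fP m mD) (fP m' mD');
    rewrite /r /= negb_and !negbK => /orP[/eqP[e]|//].
by rewrite e eqxx in ne.
Qed.

(** * Walks, suppressed vertices and paths *)

Lemma path_crossing (T : eqType) (e : rel T) (S : pred T) x p :
  path e x p -> S x -> ~~ S (last x p) ->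
  exists a b, [/\ S a, ~~ S b & e a b].
Proof.
elim: p x => [|y p IHp] x /=; first by move=> _ ->.
case/andP=> exy py Sx Sl; case: (boolP (S y)) => Sy; first exact: IHp py _ _.
by exists x, y.
Qed.

Lemma connect_crossing (T : finType) (e : rel T) (S : pred T) x y :
  connect e x y -> S x -> ~~ S y -> exists a b, [/\ S a, ~~ S b & e a b].
Proof. by case/connectP=> p px ->; apply: path_crossing px. Qed.

Lemma set2_inj (T : finType) (a b c d : T) :
  [set a; b] = [set c; d] -> (a = c /\ b = d) \/ (a = d /\ b = c).
Proof.
move=> e; have ac : a \in [set c; d] by rewrite -e !inE eqxx.
have bc : b \in [set c; d] by rewrite -e !inE eqxx orbT.
have ca : c \in [set a; b] by rewrite e !inE eqxx.
have da : d \in [set a; b] by rewrite e !inE eqxx orbT.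
move: ac bc ca da; rewrite !inE.
by case/orP=> /eqP-> /orP[] /eqP-> /orP[] /eqP + /orP[] /eqP; intuition.
Qed.

Lemma uniq_flatten_map (T : finType) (T' : eqType) (f : T ->
    seq T') (s : seq T) :
  uniq s -> {in s, forall k, uniq (f k)} ->
  {in s &, forall k k' x, x \in f k -> x \in f k' -> k = k'} ->
  uniq (flatten (map f s)).
Proof.
elim: s => //= k s IHs /andP[ks us] uf inj.
rewrite cat_uniq uf ?mem_head //= IHs // ?andbT; last 2 first.
- by move=> k' k's; apply: uf; rewrite inE k's orbT.
- by move=> k1 k2 k1s k2s; apply: inj; rewrite inE ?k1s ?k2s orbT.
apply/hasPn=> x /flattenP[_ /mapP[k' k's ->] xk']; apply/negP=> xk.
by move: ks; rewrite (inj k k' _ _ x) ?k's // inE ?eqxx // k's orbT.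
Qed.

Lemma next_neq (T : eqType) (p : seq T) x :
  uniq p -> 1 < size p -> x \in p -> next p x != x.
Proof.
move=> up sp xp; have [i q e] := rot_to xp.
rewrite -(next_rot i) // e; have := up; have := sp.
rewrite -(rot_uniq i) -(size_rot i) e; case: q {e} => //= y q _.
by rewrite inE negb_or eqxx eq_sym => /andP[/andP[]].
Qed.

Section Suppress.
Variable T : finType.
Implicit Types (e : rel T) (xs : seq T).

Lemma connect_suppress e x u v :
  u != x -> v != x -> connect e u v -> connect (suppress x e) u v.
Proof.
move=> ux vx /connectP[p pp lv]; rewrite {v}lv in vx *.
(* The second half covers a walk standing at the suppressed vertex: it remembers the predecessor
   [a], from which the new edge will start. *)
suff [h _] : (u != x -> connect (suppress x e) u (last u p)) /\
   (u = x -> forall a, a != x -> e a x -> connect (suppress x e) a (last u p)).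
  exact: h.
elim: p u {ux} pp vx => [|b p IHp] u /=.
  by move=> _ ux; split=> [_|e1]; [exact: connect0 | rewrite e1 eqxx in ux].
case/andP=> eub pp lx; have [IH1 IH2] := IHp b pp lx; split=> [ux|ux a ax eax].
  case: (eqVneq b x) => [bx|bx]; first by apply: IH2 => //; rewrite -bx.
  by apply: connect_trans (IH1 bx); apply: connect1;
    rewrite /suppress ux bx eub.
case: (eqVneq b x) => [bx|bx]; first exact: IH2.
case: (eqVneq a b) => [->|ab]; first exact: IH1.
apply: connect_trans (IH1 bx); apply: connect1.
by rewrite /suppress ax bx ab eax -ux eub orbT.
Qed.

Lemma connect_foldr_suppress e xs u v :
  u \notin xs -> v \notin xs -> connect e u v ->
  connect (foldr (@suppress T) e xs) u v.
Proof.
elim: xs => //= x xs IHxs; rewrite !inE !negb_or => /andP[ux us] /andP[vx vs]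
  euv.
by apply: connect_suppress => //; apply: IHxs.
Qed.

Lemma foldr_suppress_notin e xs u v :
  foldr (@suppress T) e xs u v -> (u \notin xs) && (v \notin xs).
Proof.
elim: xs u v => //= x xs IHxs u v /and3P[ux vx]; rewrite !inE !negb_or ux vx /=.
by case/orP=> [/IHxs//|/and3P[_ /IHxs/andP[-> _] /IHxs/andP[]]].
Qed.

Lemma foldr_suppress_irrefl e xs :
  irreflexive e -> irreflexive (foldr (@suppress T) e xs).
Proof.
move=> eI; elim: xs => //= x xs IHxs u; rewrite /suppress IHxs eqxx /=.
by rewrite !andbF.
Qed.

(** An edge surviving the suppressions stands for a walk in [e], so it satisfies every transitive
    relation containing [e]. *)
Lemma foldr_suppress_sub e xs (Q : T -> T -> Prop) u v :
  (forall a b, e a b -> Q a b) -> (forall a b c, Q a b -> Q b c -> Q a c) ->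
  foldr (@suppress T) e xs u v -> Q u v.
Proof.
move=> eQ trQ; elim: xs u v => [|x xs IHxs] u v /=; first exact: eQ.
by case/and3P=> _ _ /orP[/IHxs//|/and3P[_ /IHxs h1 /IHxs]]; apply: trQ.
Qed.

End Suppress.

Section Paths.
Variable T : sgraph.
Implicit Types (S : {set T}) (x y : T) (p : seq T).

Lemma inner_neighbours x p y :
  path (@adj T) x p -> uniq (x :: p) -> y \in x :: p -> y != x ->
    y != last x p ->
  exists a b, [/\ a != b, a \in x :: p, b \in x :: p, adj y a & adj y b].
Proof.
move=> px up + yx yl; rewrite inE (negPf yx) /= => yp.
case/splitPr: yp px up yl => p1 [|z p2] px up yl.
  by rewrite last_cat /= eqxx in yl.
move: px; rewrite cat_path /= => /and4P[_ ly yz _].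
move: up; rewrite -cat_cons cat_uniq => /and3P[_ /hasPn h _].
exists (last x p1), z; split.
- apply/eqP=> e; have := h z; rewrite !inE eqxx orbT -e => /(_ isT).
  by have := mem_last x p1; rewrite inE => ->.
- by rewrite mem_cat mem_last.
- by rewrite mem_cat !inE eqxx !orbT.
- by rewrite adj_sym.
- by [].
Qed.

Lemma card_endvertices S : is_path S -> #|endvertices S| <= 2.
Proof.
case=> x [p [px up ->]].
apply: leq_trans (_ : #|[set x; last x p]| <= 2); last by rewrite cards2;
  case: eqP.
apply: subset_leq_card; apply/subsetP=> y; rewrite !inE => /andP[yp].
apply: contraTT; rewrite negb_or => /andP[yx yl].
have [|a [b [ab ap bp ya yb]]] := inner_neighbours px up _ yx yl.
  by rewrite inE.
rewrite -ltnNge; apply: leq_trans (_ : #|[set a; b]| <= _);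
  first by rewrite cards2 ab.
apply: subset_leq_card; apply/subsetP=> c; rewrite !inE => /orP[] /eqP ->.
  by rewrite ya andbT -in_cons.
by rewrite yb andbT -in_cons.
Qed.

(** The first vertex of the path is an endvertex: a neighbour on the path other than its successor
    would close a cycle. *)
Lemma endvertices_neq0 S : is_tree T -> is_path S -> endvertices S != set0.
Proof.
case=> _ _ acyc [x [p [px up ->]]]; apply/set0Pn; exists x;
  rewrite !inE eqxx /=.
apply: leq_trans (_ : #|[set head x p]| <= 1); last by rewrite cards1.
apply: subset_leq_card; apply/subsetP=> y; rewrite !inE => /andP[+ xy].
case: (eqVneq y x) => [e|yx /=]; first by rewrite e adj_irrefl in xy.
case: p px up => // z p /= /andP[xz pz] up; rewrite inE.
case: eqVneq => //= yz yp; case/splitPr: yp pz up => p1 p2.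
rewrite cat_path /= => /and3P[pz ly _] up.
suff /acyc : ucycle (@adj T) [:: x, z & rcons p1 y] by rewrite /= size_rcons.
apply/andP; split.
  by rewrite /= xz rcons_path last_rcons rcons_path pz ly adj_sym.
have : uniq ([:: x, z & rcons p1 y] ++ p2) by rewrite /= cat_rcons.
by rewrite cat_uniq => /andP[].
Qed.

(** A path inside [S] that misses a vertex of [S] has an edge leaving it within [S]. An inner vertex
    already has two neighbours on the path, so the edge leaves from an end and prolongs the path. *)
Lemma subtree_is_path S :
  is_subtree S -> {in S, forall x, degree x <= 2} -> is_path S.
Proof.
case=> /set0Pn[x0 x0S] con deg.
suff main : forall n x p, #|S| - size p < n -> path (@adj T) x p ->
    uniq (x :: p) ->
    {subset x :: p <= S} -> is_path S.
  apply: (main _ x0 [::] (ltnSn _)) => // x.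
  by rewrite inE => /eqP->.
elim=> // n IHn x p lt px up sub.
case: (boolP (S \subset [set y in x :: p])) => [Sp|].
  exists x, p; split=> //; apply/eqP; rewrite eqEsubset Sp /=.
  by apply/subsetP=> y; rewrite inE; apply: sub.
case/subsetPn=> z zS; rewrite inE => zp.
have [a [b []]] := connect_crossing (con x z (sub _ (mem_head _ _)) zS)
  (mem_head x p) zp.
move=> ap; rewrite -[~~ _]/(b \notin x :: p) => bp /and3P[aS bS ab].
have big : (size p).+1 < #|S|.
  rewrite -[(size p).+2]/(size [:: b, x & p]) -(card_uniqP _);
    last by rewrite cons_uniq bp.
  apply: subset_leq_card; apply/subsetP=> y; rewrite inE.
  by case/orP=> [/eqP->|/sub].
have subb : {subset b :: x :: p <= S}.
  by move=> y; rewrite inE => /orP[/eqP->|/sub].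
case: (eqVneq a x) => [ax|ax].
  apply: (IHn b (x :: p)) => //=; first by lia.
    by rewrite px andbT adj_sym -ax.
  by rewrite bp.
case: (eqVneq a (last x p)) => [al|al].
  have pe : perm_eq (x :: rcons p b) (b :: x :: p).
    by rewrite -rcons_cons perm_rcons.
  apply: (IHn x (rcons p b)).
  - by rewrite size_rcons; lia.
  - by rewrite rcons_path px -al.
  - by rewrite (perm_uniq pe) cons_uniq bp.
  - by move=> y; rewrite (perm_mem pe); apply: subb.
have [u [v [uv up' vp' au av]]] := inner_neighbours px up ap ax al.
have := deg a aS; rewrite leqNgt; case/negP; rewrite /degree.
apply: leq_trans (_ : #|[set b; u; v]| <= _).
  rewrite -setUA !cardsU1 cards1 !inE (negPf uv) negb_or.
  case: eqVneq => [e|_]; first by rewrite e up' in bp.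
  by case: eqVneq => [e|_] //; rewrite e vp' in bp.
apply: subset_leq_card; apply/subsetP=> c; rewrite !inE.
by case/orP=> [/orP[]|] /eqP->.
Qed.

End Paths.

(** * The tour around the base tree *)

Section BaseTree.
Variables (G T0 : sgraph) (F : G -> {set T0}) (I : {set G}).
Hypotheses (repF : tree_representation F) (admI : admissible F I).

Lemma I_paths_disjoint u v x : u \in I -> v \in I -> x \in F u ->
    x \in F v -> u = v.
Proof.
move=> uI vI xu xv; have [[ind _] _ _] := admI; have [_ _ adjF] := repF.
apply/eqP; apply: contraT => uv; have := ind u v uI vI; rewrite adjF //.
by rewrite negbK => /eqP/setP/(_ x); rewrite !inE xu xv.
Qed.

(** Otherwise F_w is a path of degree-2 vertices containing no endvertex of an I-path, so w is not
    in I. By maximality of I it meets F_v for some v in I. It cannot leave F_v except through an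
    endvertex, so it is a proper subgraph of F_v, against the choice of I. *)
Lemma meets_unsuppressed w : exists2 t, t \in F w & t \notin suppressed F I.
Proof.
have [Ttree sub adjF] := repF; have [[ind lowI] maxI minI] := admI.
apply/exists_inP; apply: contraT => /exists_inPn h.
have {h}sup t : t \in F w -> (degree t == 2) && [forall v in I, t \notin
    endvertices (F v)].
  by move=> /h; rewrite negbK inE.
have noend v t : v \in I -> t \in F w -> t \notin endvertices (F v).
  by move=> vI /sup/andP[_ /forall_inP]; apply.
have loww : low_degree_path F w.
  have deg : {in F w, forall x, degree x <= 2} by move=> x /sup/andP[/eqP ->].
  by split=> //; apply: subtree_is_path.
have wI : w \notin I.
  apply/negP=> wI; have /set0Pn[x xe] := endvertices_neq0 Ttree loww.1.
  have := noend w x wI; rewrite xe; move: xe; rewrite inE => /andP[-> _].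
  by move/(_ isT).
have [v vI wv] : exists2 v, v \in I & adj w v.
  apply/exists_inP; apply: contraT => /exists_inPn none.
  case/negP: wI; rewrite -(maxI (w |: I)) ?setU11 ?subsetUr //; split.
    move=> a b; rewrite !inE => /orP[/eqP->|aI] /orP[/eqP->|bI].
    - by rewrite adj_irrefl.
    - exact: none.
    - by rewrite adj_sym none.
    - exact: ind.
  by move=> a; rewrite !inE => /orP[/eqP->//|]; apply: lowI.
have nwv : w != v by apply: contraNneq wI => ->.
move: wv; rewrite adjF // => /set0Pn[y]; rewrite inE => /andP[yw yv].
suff wsubv : F w \subset F v.
  have /negP[] := minI v vI w; apply/properP; split=> //.
  have /set0Pn[x xe] := endvertices_neq0 Ttree (lowI v vI).1.
  exists x; first by move: xe; rewrite inE => /andP[].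
  by apply: contraL xe; apply: noend.
apply: contraT => /subsetPn[z zw zv].
have [a [b [av bv /and3P[aw bw ab]]]] :=
    connect_crossing ((sub w).2 y z yw zw) yv zv.
have := noend v a vI aw; rewrite inE negb_and [a \in _]av /= -ltnNge => two.
have /andP[/eqP da _] := sup a aw.
have e : [set y in F v | adj a y] = [set y | adj a y].
  apply/eqP; rewrite eqEcard [X in _ && X](leq_trans _ two) ?andbT; last first.
    by rewrite -/(degree a) da.
  by apply/subsetP=> c; rewrite !inE => /andP[].
by move/setP/(_ b): e; rewrite !inE ab andbT [LHS](negPf bv).
Qed.

Lemma unsuppressed_endvertex v x :
  v \in I -> x \in F v -> x \notin suppressed F I -> x \in endvertices (F v).
Proof.
have [[_ lowI] _ _] := admI.
move=> vI xv; rewrite inE negb_and => /orP[dx|].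
  have := (lowI v vI).2 x xv; rewrite leq_eqVlt (negPf dx) /= ltnS => d1.
  rewrite inE xv; apply: leq_trans d1; apply: subset_leq_card.
  by apply/subsetP=> y; rewrite !inE => /andP[].
case/forall_inPn=> u uI; rewrite negbK => xu.
suff -> : v = u by [].
by apply: (@I_paths_disjoint _ _ x) => //; move: xu; rewrite inE => /andP[].
Qed.

(** I-paths are disjoint, so the red edges merged into [e] lie on a single one. The ends of [e] are
    unsuppressed, hence endvertices of that path, which has at most two. *)
Lemma red_edge_I_path e :
  e \in red_edges F I -> exists2 v, v \in I & e = endvertices (F v).
Proof.
have [[_ lowI] _ _] := admI.
rewrite inE => /existsP[r /existsP[s /andP[/eqP-> rs]]].
have [v [vI rv sv]] : exists v, [/\ v \in I, r \in F v & s \in F v].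
  apply: (foldr_suppress_sub (Q := fun a b =>
    exists v, [/\ v \in I, a \in F v & b \in F v])) rs => [a b /andP[_]|a b c].
    by case/exists_inP=> v vI /andP[av bv]; exists v.
  case=> v [vI av bv] [u [uI bu cu]]; exists v; split=> //.
  by rewrite (@I_paths_disjoint v u b).
have := foldr_suppress_notin rs; rewrite !mem_enum => /andP[ru su].
have rs' : r != s.
  apply: contraTneq rs => ->; rewrite /base_red foldr_suppress_irrefl // => x.
  by rewrite /red adj_irrefl.
exists v => //; apply/eqP; rewrite eqEcard cards2 rs' card_endvertices ?andbT;
  last first.
  exact: (lowI v vI).1.
by apply/subsetP=> x /set2P[] ->; apply: unsuppressed_endvertex.
Qed.

Lemma base_connected u v :
  u \notin suppressed F I -> v \notin suppressed F I ->
    connect (base_adj F I) u v.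
Proof.
move=> us vs; have [[_ con _] _ _] := repF.
by apply: connect_foldr_suppress (con u v); rewrite mem_enum.
Qed.

Lemma overspan_sub_card e (E : {set G}) :
  E \in overspan F I e -> (E \subset ~: I) && (#|E| <= 2).
Proof.
case/setUP=> [/imsetP[v]|/imset2P[u v]].
  by rewrite inE => /andP[vI _] ->; rewrite sub1set vI cards1.
move=> uI; rewrite inE => /andP[vI _] ->.
by rewrite subUset !sub1set uI vI cards2; case: eqP.
Qed.

Definition meet (a b : G) := F a :&: F b != set0.

(** The subtrees of [c] jointly carry a walk of [T0] from [x] to [y]. Since [meet] also holds on the
    diagonal, such sequences concatenate freely; distinctness matters only when the final cycle is
    formed. *)
Definition leads (x : T0) (c : seq G) (y : T0) : bool :=
  if c is a :: c' then [&& x \in F a, path meet a c' & y \in F (last a c')]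
  else x == y.

Lemma meet_common x a b : x \in F a -> x \in F b -> meet a b.
Proof. by move=> xa xb; apply/set0Pn; exists x; rewrite inE xa. Qed.

Lemma leads_cat x c y c' z : leads x c y -> leads y c' z -> leads x (c ++ c') z.
Proof.
case: c => [/eqP->//|a c] /and3P[xa pc yl].
case: c' => [/eqP<-|b c'] /=; first by rewrite cats0 xa pc.
case/and3P=> yb pc' zl; rewrite xa cat_path pc /= pc' last_cat zl !andbT.
exact: meet_common yl yb.
Qed.

Lemma leads_all t c : {in c, forall a, t \in F a} -> leads t c t.
Proof.
elim: c => [|a c IHc] h; first by rewrite /= eqxx.
rewrite -cat1s; apply: (@leads_cat _ _ t).
  by rewrite /= h ?mem_head.
by apply: IHc => b bc; apply: h; rewrite inE bc orbT.
Qed.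

Lemma leads_cycle t c : leads t c t -> cycle meet c.
Proof.
case: c => //= a c /and3P[ta pc tl]; rewrite rcons_path pc /=.
exact: meet_common tl ta.
Qed.

Lemma meet_cycle_ucycle c :
  uniq c -> 1 < size c -> cycle meet c -> ucycle (@adj G) c.
Proof.
move=> uc sc cc; apply/andP; split=> //; apply: cycle_from_next => // x xc.
have [_ _ adjF] := repF; rewrite adjF; first exact: (next_cycle cc xc).
by rewrite eq_sym next_neq.
Qed.

(** A loop crosses the edge with one vertex, a link with two; the order of the two depends on the
    direction of crossing. *)
Lemma overspan_leads r s (E : {set G}) :
  E \in overspan F I [set r; s] ->
  exists2 c, leads r c s & perm_eq c (enum E).
Proof.
case/setUP=> [/imsetP[v]|/imset2P[u v]].
  rewrite inE subUset !sub1set => /and3P[_ rv sv] ->; exists [:: v].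
    by rewrite /= rv sv.
  by rewrite enum_set1.
move=> uI; rewrite inE => /and4P[_ uv auv /existsP[r' /existsP[s' /and3P[/eqP e
  ru sv]]]] ->.
have [_ _ adjF] := repF.
have muv : meet u v by rewrite /meet -adjF.
have vu : v != u by rewrite eq_sym.
case: (set2_inj e) => -[-> ->].
  exists [:: u; v]; first by rewrite /= ru sv muv.
  apply: uniq_perm; rewrite ?enum_uniq //= ?inE ?uv // => x.
  by rewrite mem_enum !inE.
exists [:: v; u]; first by rewrite /= sv ru /meet setIC -/(meet u v) muv.
apply: uniq_perm; rewrite ?enum_uniq //= ?inE ?vu // => x.
by rewrite mem_enum !inE orbC.
Qed.

Section Tour.
Variable K : {set T0} * bool -> {set G}.
Hypothesis K_leads : forall r s b, [set r; s] \in base_edges F I ->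
  exists2 c, leads r c s & perm_eq c (enum (K ([set r; s], b))).

(* Doubled spanning tree of the base tree, traversed by a closed walk. The
   universally quantified [ins] reserves, at each visited vertex, a place for a
   later detour; extending the walk by an edge is an instance of it. *)
Lemma base_tour (t0 : T0) n : t0 \notin suppressed F I ->
    n < #|~: suppressed F I| ->
  exists (S : seq T0) (L : seq ({set T0} * bool)),
  [/\ [/\ uniq S, size S = n.+1 & t0 \in S], {subset S <= ~: suppressed F I},
    uniq L,
      {in L, forall k, (k.1 \in base_edges F I) && (k.1 \subset S)}
    & forall ins : T0 -> seq G, (forall t, leads t (ins t) t) ->
      exists2 c, leads t0 c t0 &
        perm_eq c (flatten [seq enum (K k) | k <- L] ++ flatten [seq ins t | t
          <- S])].
Proof.
move=> t0s; elim: n => [_|n IHn lt].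
  exists [:: t0], [::]; split=> //.
  - by rewrite mem_head.
  - by move=> x; rewrite inE => /eqP->; rewrite inE.
  - by move=> ins h; exists (ins t0); rewrite //= cats0.
have [S [L [[uS sS t0S] SU uL LP tour]]] := IHn (ltnW lt).
have [v vU vS] : exists2 v, v \in ~: suppressed F I & v \notin S.
  apply/subsetPn; apply/negP=> /subset_leq_card.
  by rewrite (card_uniqP uS) sS leqNgt lt.
rewrite inE in vU.
have [r [s [rS sNS rs]]] := connect_crossing (base_connected t0s vU) t0S vS.
have {}rS : r \in S := rS; have {}sNS : s \notin S := sNS.
have /andP[_] := foldr_suppress_notin rs; rewrite mem_enum => sU.
set e := [set r; s].
have eB : e \in base_edges F I.
  by rewrite inE; apply/existsP; exists r; apply/existsP; exists s;
    rewrite eqxx.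
have [c1 c1l c1p] := @K_leads r s false eB.
have [c2 c2l c2p] : exists2 c, leads s c r & perm_eq c (enum (K (e, true))).
  by rewrite /e setUC; apply: K_leads; rewrite setUC.
have eS : ~~ (e \subset S) by apply: contra sNS => /subsetP; apply;
    rewrite !inE eqxx orbT.
exists (s :: S), [:: (e, false), (e, true) & L]; split.
- by rewrite /= sNS uS sS inE t0S orbT.
- by move=> x; rewrite inE => /orP[/eqP->|/SU//]; rewrite inE.
- have h b : (e, b) \notin L by apply: contra eS => /LP/andP[].
  by rewrite /= inE !negb_or !h uL xpair_eqE andbF.
- have sub (f : {set T0}) : f \subset S -> f \subset s :: S.
    by move=> fS; apply: subset_trans fS _; apply/subsetP=> x xS;
      rewrite inE xS orbT.
  have es : e \subset s :: S by apply/subsetP=> x;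
      rewrite !inE => /orP[]/eqP->; rewrite ?rS ?eqxx ?orbT.
  by move=> k; rewrite 2!in_cons => /or3P[/eqP->|/eqP->|/LP/andP[-> /sub]] //=;
    rewrite eB.
move=> ins insP.
(* The detour from [r] crosses [e] by its first copy, makes the insertions at [s], and returns by
   the second copy. *)
pose d := c1 ++ ins s ++ c2.
have [t|c cl cp] := tour (fun t => if t == r then ins r ++ d else ins t).
  case: eqP => [->|_]; last exact: insP.
  exact: leads_cat (insP r) (leads_cat c1l (leads_cat (insP s) c2l)).
exists c => //; apply: perm_trans cp _.
have pS := perm_to_rem rS.
have e1 : perm_eq (flatten [seq if t == r then ins r ++ d else ins t | t <- S])
   (d ++ flatten [seq ins t | t <- S]).
  have p1 := perm_flatten (perm_map (fun t => if t == r then ins r ++ d else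
      ins t) pS).
  have p2 := perm_flatten (perm_map ins pS).
  have p3 : [seq if t == r then ins r ++ d else ins t | t <- rem r S] = [seq
      ins t | t <- rem r S].
    by apply/eq_in_map=> t; rewrite mem_rem_uniq // inE => /andP[/negPf->].
  move: p1 p2; rewrite /= eqxx p3 => p1 p2; apply/permP=> a.
  by rewrite (permP p1) [RHS]count_cat (permP p2) !count_cat -addnA addnCA.
apply/permP=> a; rewrite /= !count_cat (permP e1) !count_cat (permP c1p) (permP
  c2p).
by do !move: (count _ _) => ?; clear; lia.
Qed.

End Tour.

Lemma representatives_hamiltonian (f : {set T0} * bool -> {set G}) :
  3 <= #|G| ->
  {in overspan_family F I, forall m, f m \in overspan F I m.1} ->
  {in overspan_family F I &, forall m m', m != m' -> [disjoint f m & f m']} ->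
  hamiltonian G.
Proof.
move=> G3 fP fdis.
have /fin_all_exists[vI vIP] (e : {set T0}) : exists v, e \in red_edges F I ->
    v \in I /\ e = endvertices (F v).
  case: (boolP (e \in red_edges F I)) => [/red_edge_I_path[v h1 h2]|_].
    by exists v.
  by have [v _] := card_gt0P (ltnW (ltnW G3)); exists v.
(* The copy [(e, true)] of a red edge lies outside the family; the vertex of I whose path is [e]
   takes its place. Representatives avoid I, so disjointness persists. *)
pose K m := if (m.1 \in red_edges F I) && m.2 then [set vI m.1] else f m.
have Kfam m : m.1 \in base_edges F I -> ~~ ((m.1 \in red_edges F I) && m.2) ->
    m \in overspan_family F I.
  by move=> h; rewrite negb_and -implybE => k; rewrite in_set; apply/andP.
have Kdis m m' : m.1 \in base_edges F I -> m'.1 \in base_edges F I -> m != m' ->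
    [disjoint K m & K m'].
  move=> mB mB' mm'; rewrite /K.
  have out k : k \in overspan_family F I -> [disjoint f k & I].
    by move=> /fP/overspan_sub_card/andP[+ _]; rewrite disjoints_subset.
  case: ifPn => [/andP[mr m2]|/(Kfam _ mB) mF];
    case: ifPn => [/andP[mr' m2']|/(Kfam _ mB') mF'].
  - have [i1 e1] := vIP _ mr; have [i2 e2] := vIP _ mr'.
    rewrite disjoints1 inE; apply: contra mm' => /eqP e.
    case: m m' m2 m2' e1 e2 e {mB mB' mr mr' i1 i2} => [e1 []] [e2 []] //= _ _
      h1 h2 h3.
    by rewrite h1 h2 h3.
  - rewrite disjoint_sym; apply: disjointWr (out _ mF').
    by rewrite sub1set (vIP _ mr).1.
  - apply: disjointWr (out _ mF).
    by rewrite sub1set (vIP _ mr').1.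
  - exact: fdis.
have Klead r s b : [set r; s] \in base_edges F I ->
    exists2 c, leads r c s & perm_eq c (enum (K ([set r; s], b))).
  move=> eB; rewrite /K; case: ifPn => [/andP[er _]|/(Kfam (_, _) eB) h].
    have /= [_ e] := vIP _ er; exists [:: vI [set r; s]];
        last by rewrite enum_set1.
    have h x : x \in [set r; s] -> x \in F (vI [set r; s]).
      by rewrite {1}e inE => /andP[].
    by rewrite /= !h // !inE eqxx ?orbT.
  exact: overspan_leads (fP _ h).
(* [loc w] is the base-tree vertex at which [w] is inserted if no crossing uses it. *)
have /fin_all_exists2[loc locF locU] := meets_unsuppressed.
have [g _] := card_gt0P (ltnW (ltnW G3)).
have U0 : 0 < #|~: suppressed F I| by apply/card_gt0P; exists (loc g);
    rewrite inE locU.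
(* The tour visits n + 1 vertices, so this [n] makes [S] exhaust the base tree. *)
have [|S [L [[uS sS t0S] SU uL LP tour]]] :=
  base_tour Klead (n := #|~: suppressed F I|.-1) (locU g);
    first by rewrite prednK.
have locS w : loc w \in S.
  apply: contraT => nS.
  have : size (loc w :: S) <= #|~: suppressed F I|.
    rewrite -(card_uniqP (_ : uniq (loc w :: S))); last by rewrite /= nS.
    apply: subset_leq_card; apply/subsetP=> x;
      rewrite inE => /orP[/eqP->|/SU//].
    by rewrite inE locU.
  by rewrite /= sS prednK // ltnn.
pose used w := has (fun k => w \in K k) L.
pose ins t := [seq w <- enum G | ~~ used w && (loc w == t)].
have [t|c cl cp] := tour ins.
  by apply: leads_all => a; rewrite mem_filter => /andP[/andP[_ /eqP<-] _].
have memL w : (w \in flatten [seq enum (K k) | k <- L]) = used w.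
  apply/flattenP/hasP => [[_ /mapP[k kL ->]]|[k kL wk]].
    by rewrite mem_enum; exists k.
  by exists (enum (K k)); rewrite ?mem_enum //; apply/mapP; exists k.
have memS w : (w \in flatten [seq ins t | t <- S]) = ~~ used w.
  apply/flattenP/idP => [[_ /mapP[t _ ->]]|nu].
    by rewrite mem_filter => /andP[/andP[]].
  exists (ins (loc w)); first by apply/mapP; exists (loc w).
  by rewrite mem_filter nu eqxx mem_enum.
have uc : uniq c.
  rewrite (perm_uniq cp) cat_uniq; apply/and3P; split.
  - apply: uniq_flatten_map => // [k _|k k' kL kL' x]; first exact: enum_uniq.
    rewrite !mem_enum => xk xk'; apply/eqP; apply: contraT => kk'.
    have /andP[b1 _] := LP _ kL; have /andP[b2 _] := LP _ kL'.
    have := Kdis k k' b1 b2 kk'; rewrite -setI_eq0 => /eqP/setP/(_ x).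
    by rewrite !inE xk xk'.
  - by apply/hasPn=> w; rewrite memS => nu; rewrite /= memL.
  - apply: uniq_flatten_map => // [t _|t t' _ _ x].
      by rewrite filter_uniq ?enum_uniq.
    rewrite !mem_filter => /andP[/andP[_ /eqP<-] _] /andP[/andP[_ /eqP<-] _].
    by [].
have allc w : w \in c by rewrite (perm_mem cp) mem_cat memL memS orbN.
have sc : 3 <= size c.
  by rewrite -(card_uniqP uc) (eq_card (B := G)).
exists c; split=> //; apply: meet_cycle_ucycle => //; first exact: ltnW.
exact: leads_cycle cl.
Qed.

End BaseTree.

(* The hypothesis on B is nu > 2|B| - 2 over the integers, written without
   truncated subtraction. *)
Theorem lemma3p3 (G : sgraph) (T0 : sgraph) (F : G -> {set T0}) (I : {set G})
  (hG : chordal G) (hcard : 3 <= #|G|)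
  (hF : minimum_tree_representation F) (hI : admissible F I)
  (hB : forall B : {set {set T0} * bool}, B \subset overspan_family F I ->
     2 * #|B| < matching_number (overspan_union F I B) + 2) :
  hamiltonian G.
Proof.
have [f fP fdis] := disjoint_representatives
  (fun m _ E EA => proj2 (andP (overspan_sub_card EA))) hB.
exact: representatives_hamiltonian hF.1 hI f hcard fP fdis.
Qed.
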